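(* Let $\epsilon>0$ and $A\geq 0$, and let $f(a,n)$, defined for integers $1\le a\le n$, satisfy $|f(a,n)|\leq A$ and depend only on the connected component of $a$ in the divisor graph of the interval $[a,n]$. Define \[C_f = \sum_{i=1}^\infty \sum_{\substack{d\\ P^+(d)\leq i}} \sum_{t \in [id,(i+1)d)} \left(\frac{f(d,t)}{t(t+1)}\prod_{p\leq i} \frac{p-1}{p}\right),\] where $d$ runs over positive integers, $t$ over integers, and $p$ over primes. Then \[\sum_{a=1}^n f(a,n) = nC_f + O_A\left(n\exp\left(-\sqrt{\left(\tfrac{1}{6}-\epsilon\right)\log n \log \log n}\right)\right).\]
   Context: The divisor graph of a set $S$ of positive integers has vertex set $S$, with two distinct elements joined by an edge if one divides the other. For integers $a\le n$, the divisor graph of the interval $[a,n]$ is the divisor graph of $\{a,a+1,\ldots,n\}$. A function $f(a,n)$ depends only on the connected component of $a$ in the divisor graph of $[a,n]$ if $f(a,n)=f(b,m)$ whenever the connected component of $a$ in the divisor graph of $[a,n]$ is isomorphic (as a graph) to the connected component of $b$ in the divisor graph of $[b,m]$ via an isomorphism sending $a$ to $b$. $P^+(d)$ denotes the largest prime factor of $d$, with the convention $P^+(1)=1$. *)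

(* Defs.v *)
From HB Require Import structures.
From mathcomp Require Import all_boot all_order all_algebra.
From mathcomp Require Import all_classical all_reals all_analysis.
Set Implicit Arguments.
Unset Strict Implicit.
Unset Printing Implicit Defensive.
Import Order.TTheory GRing.Theory Num.Theory.
Import numFieldNormedType.Exports.
Local Open Scope classical_set_scope.
Local Open Scope ring_scope.

(* The relation lives on the whole of nat; integers outside S are isolated. *)
Definition divisor_graph (S : pred nat) : rel nat :=
  fun x y => [&& S x, S y, x != y & (x %| y)%N || (y %| x)%N].

Definition interval (a n : nat) : pred nat := fun x => (a <= x <= n)%N.

Definition component (e : rel nat) (a : nat) : set nat :=
  [set x | exists2 p, path e a p & last a p = x].

(* Isomorphism of the subgraphs induced by e1 on V1 and by e2 on V2, with
   distinguished vertices a and b. *)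
Definition rooted_isomorphic (e1 e2 : rel nat) (V1 V2 : set nat) (a b : nat) :=
  exists phi : nat -> nat,
    [/\ set_bij V1 V2 phi,
        forall x y, V1 x -> V1 y -> e2 (phi x) (phi y) = e1 x y
      & phi a = b].

Definition depends_only_on_component (T : Type) (f : nat -> nat -> T) :=
  forall a n b m : nat, (1 <= a <= n)%N -> (1 <= b <= m)%N ->
    let G := divisor_graph (interval a n) in
    let H := divisor_graph (interval b m) in
    rooted_isomorphic G H (component G a) (component H b) a b ->
    f a n = f b m.

(* max_pdiv 1 = 1 in the library, which is the convention P^+(1) = 1. *)
Definition Cf_term (R : realType) (f : nat -> nat -> R) (i d : nat) : R :=
  \sum_((i * d)%N <= t < (i.+1 * d)%N)
    (f d t / (t%:R * (t%:R + 1))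
     * \prod_(1 <= p < i.+1 | prime p) ((p%:R - 1) / p%:R)).

Definition Cf_inner_partial (R : realType) (f : nat -> nat -> R) (i : nat)
    : R^nat :=
  fun N => \sum_(1 <= d < N.+1 | (max_pdiv d <= i)%N) Cf_term f i d.

Definition Cf_partial (R : realType) (f : nat -> nat -> R) : R^nat :=
  fun N => \sum_(1 <= i < N.+1) limn (Cf_inner_partial f i).

Definition Cf (R : realType) (f : nat -> nat -> R) : R := limn (Cf_partial f).

(* limn has an arbitrary value on divergent sequences; this predicate says
   that all the limits defining Cf f exist. *)
Definition Cf_converges (R : realType) (f : nat -> nat -> R) : Prop :=
  (forall i, (1 <= i)%N -> cvgn (Cf_inner_partial f i)) /\ cvgn (Cf_partial f).

(* Main.v *)
(** Write i = floor(n/a) and a = d q with d the i-smooth part of a and q its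
    i-rough part. Along an edge of the divisor graph of [a,n] one multiplies or
    divides by at most i, so division by q carries the component of a to the
    component of d in [d, floor(n/q)], and f(a,n) = f(d, floor(n/q)). For fixed
    t = floor(n/q) the admissible q are the i-rough integers of (n/(t+1), n/t],
    whose number is about n/(t(t+1)) prod_(p <= i) (1 - 1/p); this gives n C_f.

    Fix J and k with J^(3k+2) <= n. The layers i >= J contribute O(n/J). In the
    others, the d >= J^k are discarded by Rankin's trick with weight d^sigma,
    J^sigma = z, and for d < J^k the rough integers are counted by Buchstab's
    identity cut off at depth k. Both errors are n z^-k exp(O(z S)) with
    S = sum_(p <= J) 1/p = O(log log J). The theorem follows with
    J = exp(c sqrt(log n log log n)), c^2 = 1/6 - eps, z = (log n)^(1/2 - eps). *)

Require Import Defs.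
From HB Require Import structures.
From mathcomp Require Import all_boot all_order all_algebra.
From mathcomp Require Import all_classical all_reals all_analysis.
From mathcomp Require Import ring lra zify.
Import Order.TTheory GRing.Theory Num.Theory.
Import numFieldNormedType.Exports.
Local Open Scope classical_set_scope.
Local Open Scope ring_scope.

Set Implicit Arguments.
Unset Strict Implicit.
Unset Printing Implicit Defensive.

(** As a [nat_pred], it makes [(upto i).-nat] the i-smooth and [((upto i)^'%N).-nat] the i-rough
    integers, so the theory of pi-parts supplies the factorization [a = d * q]. *)
Definition upto (i : nat) : nat_pred := [pred p | (p <= i)%N].

Lemma max_pdiv_upto (d i : nat) :
  (0 < d)%N -> (0 < i)%N -> (max_pdiv d <= i)%N = (upto i).-nat d.
Proof.
move=> d0 i0; apply/idP/idP => [le_di|d_smooth].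
  apply/pnatP => // p p_pr p_dvd; rewrite inE.
  by apply: leq_trans (max_pdiv_max _) le_di; rewrite mem_primes p_pr d0.
have [d1|d_le1] := ltnP 1 d; last by have -> : d = 1%N by lia.
have /pnatP := d_smooth; move=> /(_ d0 _ (max_pdiv_prime d1) (max_pdiv_dvd d)).
by rewrite inE.
Qed.

(** * Multiplication by a rough factor as an isomorphism of components *)

Section Scaling.
Variables (d q n : nat).
Hypotheses (d_gt0 : (0 < d)%N) (q_gt0 : (0 < q)%N) (le_dq_n : (d * q <= n)%N).
Hypothesis q_rough : ((upto (n %/ (d * q)))^'%N).-nat q.

Let G := divisor_graph (Defs.interval d (n %/ q)).
Let H := divisor_graph (Defs.interval (d * q) n).

Lemma divisor_graph_scale (x y : nat) : H (x * q)%N (y * q)%N = G x y.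
Proof.
rewrite /G /H /divisor_graph /Defs.interval !leq_pmul2r // -!leq_divRL //.
by rewrite eqn_pmul2r // !dvdn_pmul2r.
Qed.

(* Along an edge one multiplies or divides by some k <= n / (d q), which is
   coprime to the rough factor q. *)
Lemma divisor_graph_dvd (x y : nat) : H (x * q)%N y -> (q %| y)%N.
Proof.
case/and4P=> /andP[xq_ge xq_le] /andP[y_ge _] _ /orP[xq_dvd|/dvdnP[k xqE]].
  exact: dvdn_trans (dvdn_mull x (dvdnn q)) xq_dvd.
have k_gt0 : (0 < k)%N.
  by case: k xqE => // xq0; move: xq_ge; rewrite xq0 leqNgt muln_gt0 d_gt0 q_gt0.
have k_le : (k <= n %/ (d * q))%N.
  rewrite leq_divRL ?muln_gt0 ?d_gt0 //.
  by apply: leq_trans xq_le; rewrite xqE leq_mul2l y_ge orbT.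
have k_smooth : (upto (n %/ (d * q))).-nat k.
  apply/pnatP => // p _ p_dvd; rewrite inE.
  exact: leq_trans (dvdn_leq k_gt0 p_dvd) k_le.
rewrite -(@Gauss_dvdr q k); last by rewrite coprime_sym (pnat_coprime k_smooth).
by rewrite -xqE dvdn_mull.
Qed.

Lemma divisor_graph_path (x : nat) (p : seq nat) : path H (x * q)%N p ->
  exists2 p', path G x p' & p = map (muln^~ q) p'.
Proof.
elim: p x => [|y p IH] x /=; first by exists [::].
case/andP=> Hxy; have /dvdnP[y' yE] := divisor_graph_dvd Hxy.
rewrite yE in Hxy * => /IH[p' p'_path ->]; exists (y' :: p') => //=.
by rewrite -divisor_graph_scale Hxy.
Qed.

(** Scaling preserves edges both ways, so it carries paths from [d] to paths from [d * q]. A path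
    from [d * q] stays among the multiples of [q] and lifts back, which gives surjectivity. *)
Lemma component_scale :
  rooted_isomorphic G H (component G d) (component H (d * q)%N) d (d * q)%N.
Proof.
exists (muln^~ q); split => // [|x y _ _]; last exact: divisor_graph_scale.
split.
- move=> _ [p p_path <-]; exists (map (muln^~ q) p); last by rewrite (last_map (muln^~ q)).
  rewrite (@path_map _ _ (muln^~ q)); apply: sub_path p_path => x y /=.
  by rewrite divisor_graph_scale.
- by move=> x y _ _ /eqP; rewrite eqn_pmul2r // => /eqP.
- move=> _ [p /divisor_graph_path[p' p'_path ->] <-].
  by exists (last d p'); [exists p' | rewrite (last_map (muln^~ q))].
Qed.

(** The rest of the proof uses only this identity and the bound on [f]. *)
Lemma depends_only_scale (T : Type) (f : nat -> nat -> T) :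
  depends_only_on_component f -> f (d * q)%N n = f d (n %/ q)%N.
Proof.
move=> hf; apply/esym/hf; last exact: component_scale.
  by rewrite d_gt0 leq_divRL.
by rewrite muln_gt0 d_gt0 q_gt0.
Qed.

End Scaling.

(** * Reindexing sums by multiples and by pi-parts *)

Lemma sum_multiples (V : nmodType) (F : nat -> V) (P : pred nat) (d n : nat) :
  (0 < d)%N ->
  \sum_(1 <= a < n.+1 | (d %| a)%N && P a) F a =
  \sum_(1 <= q < n.+1 | (d * q <= n)%N && P (d * q)%N) F (d * q)%N.
Proof.
move=> d_gt0.
transitivity (\sum_(1 <= a < n.+1 | P a)
                \sum_(1 <= q < n.+1 | a == (d * q)%N) F a).
  rewrite big_mkcondl [LHS]big_nat_cond [RHS]big_nat_cond.
  apply: eq_bigr => a /andP[/andP[a_gt0 a_le] _].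
  case: ifPn => [/dvdnP[q aE]|ndvd].
    rewrite (eq_bigl (fun j => j == q)); last first.
      by move=> j; rewrite aE mulnC eqn_pmul2l // eq_sym.
    rewrite big_nat1_eq ifT //.
    by move: a_gt0 a_le; rewrite aE; nia.
  rewrite big_pred0 // => q; apply: contraNF ndvd => /eqP ->.
  exact: dvdn_mulr.
rewrite (exchange_big_dep xpredT) //= [RHS]big_mkcond.
apply: eq_big_nat => q /andP[q_gt0 _].
case: ifPn => [/andP[dq_le Pdq]|].
  rewrite (eq_bigl (fun a => a == (d * q)%N)); last first.
    by move=> a; case: eqP => [->|]; rewrite ?Pdq ?andbF.
  by rewrite big_nat1_eq ltnS dq_le muln_gt0 d_gt0 q_gt0.
rewrite negb_and => dqN; rewrite big_nat_cond big_pred0 // => a.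
apply/negbTE; move: dqN; apply: contraL; case/and3P=> /andP[_ a_le] Pa /eqP aE.
by rewrite -aE Pa -ltnS a_le.
Qed.

Lemma sum_by_part (V : nmodType) (F : nat -> V) (pi : nat_pred) (P : pred nat)
    (n : nat) :
  \sum_(1 <= a < n.+1 | P a) F a =
  \sum_(1 <= d < n.+1 | pi.-nat d)
    \sum_(1 <= q < n.+1 | [&& (pi^'%N).-nat q, (d * q <= n)%N & P (d * q)%N])
      F (d * q)%N.
Proof.
transitivity (\sum_(1 <= a < n.+1 | P a)
                \sum_(1 <= d < n.+1 | d == (a`_pi)%N) F a).
  rewrite [LHS]big_nat_cond [RHS]big_nat_cond.
  apply: eq_bigr => a /andP[/andP[a_gt0 a_le] _].
  rewrite big_nat1_eq part_gt0 ltnS ifT //.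
  exact: leq_trans (dvdn_leq a_gt0 (dvdn_part _ _)) a_le.
rewrite (exchange_big_dep xpredT) //= [RHS]big_mkcond.
apply: eq_big_nat => d /andP[d_gt0 _]; case: ifPn => [d_pi|dN]; last first.
  rewrite big_pred0 // => a; apply: contraNF dN => /andP[_ /eqP ->].
  exact: part_pnat.
transitivity (\sum_(1 <= a < n.+1 | (d %| a)%N && (P a && (d == (a`_pi)%N))) F a).
  apply: eq_bigl => a; case: (P a) => //=; last by rewrite andbF.
  by case: eqP => [->|_]; rewrite ?andbF // dvdn_part.
rewrite sum_multiples // [LHS]big_nat_cond [RHS]big_nat_cond.
apply: eq_bigl => q; case: (boolP (1 <= q < _)%N) => //= /andP[q_gt0 _].
(* For a pi-number [d], the pi-part of [d * q] is [d] times that of [q], so it is [d] exactly when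
   [q] has trivial pi-part. *)
have -> : (d == ((d * q)`_pi)%N) = (pi^'%N).-nat q.
  rewrite partnM // part_pnat_id // -{1}[d]muln1 eqn_pmul2l // eq_sym.
  apply/eqP/idP => [q1|/part_p'nat //].
  by rewrite -(partnC pi q_gt0) q1 mul1n part_pnat.
by rewrite [RHS]andbC -andbA.
Qed.

(** * Sieving by the primes at most i *)

Lemma rough_prime (i q : nat) : (0 < q)%N -> prime i.+1 ->
  ((upto i.+1)^'%N).-nat q = ((upto i)^'%N).-nat q && ~~ (i.+1 %| q)%N.
Proof.
move=> q_gt0 p_pr; apply/idP/andP => [q_rough|[q_rough ndvd]].
  split.
    apply/pnatP => // p pp pq; have /pnatP := q_rough.
    by move=> /(_ q_gt0 _ pp pq); rewrite !inE -!ltnNge; lia.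
  apply/negP => pq; have /pnatP := q_rough.
  by move=> /(_ q_gt0 _ p_pr pq); rewrite !inE leqnn.
apply/pnatP => // p pp pq; have /pnatP := q_rough.
move=> /(_ q_gt0 _ pp pq); rewrite !inE -!ltnNge => ip.
by rewrite ltn_neqAle ip andbT; apply: contraNneq ndvd => ->.
Qed.

Lemma upto_nprime (i d : nat) : (0 < d)%N -> ~~ prime i.+1 ->
  (upto i.+1).-nat d = (upto i).-nat d.
Proof.
move=> d_gt0 npr; apply/pnatP/pnatP => // d_s p pp pd; move: (d_s p pp pd);
  rewrite !inE; last by lia.
by rewrite leq_eqVlt => /orP[/eqP pE|//]; rewrite -pE pp in npr.
Qed.

Lemma rough_nprime (i q : nat) : (0 < q)%N -> ~~ prime i.+1 ->
  ((upto i.+1)^'%N).-nat q = ((upto i)^'%N).-nat q.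
Proof.
move=> q_gt0 npr; apply/pnatP/pnatP => // q_r p pp pq; move: (q_r p pp pq);
  rewrite !inE -!ltnNge; first by lia.
by rewrite leq_eqVlt => /orP[/eqP pE|//]; rewrite pE pp in npr.
Qed.

Section Sieve.
Variable R : realType.
Implicit Types (n i a b q d k : nat) (z : R).

Definition sift_density i : R :=
  \prod_(1 <= p < i.+1 | prime p) ((p%:R - 1) / p%:R).

Definition recip_primes i : R := \sum_(1 <= p < i.+1 | prime p) p%:R^-1.

(** The window n/b < q <= n/a is written without division, so that multiplying [a] and [b] by a
    prime is exact. *)
Definition rough_count n i a b : R :=
  \sum_(1 <= q < n.+1 | ((upto i)^'%N).-nat q && (a * q <= n < b * q)%N) 1.

(** The length of the interval in which [rough_count] looks for [q]. *)
Definition window n a b : R := n%:R * (a%:R^-1 - b%:R^-1).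

Lemma big_prime_recr (T : Type) (idx : T) (op : Monoid.law idx) i (F : nat -> T) :
  \big[op/idx]_(1 <= p < i.+2 | prime p) F p =
  (if prime i.+1 then op (\big[op/idx]_(1 <= p < i.+1 | prime p) F p) (F i.+1)
   else \big[op/idx]_(1 <= p < i.+1 | prime p) F p).
Proof.
rewrite big_mkcond big_nat_recr //= -big_mkcond.
by case: ifP => // _; rewrite Monoid.mulm1.
Qed.

Lemma sift_density_ge0 i : 0 <= sift_density i.
Proof.
rewrite /sift_density big_seq_cond; apply: prodr_ge0 => p.
rewrite mem_index_iota => /andP[/andP[p1 _] _].
by rewrite divr_ge0 ?subr_ge0 ?ler1n.
Qed.

Lemma sift_density_le1 i : sift_density i <= 1.
Proof.
elim: i => [|i IH]; first by rewrite /sift_density big_geq.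
rewrite /sift_density big_prime_recr /=; case: ifP => // _.
apply: mulr_ile1 => //; first exact: sift_density_ge0.
by rewrite ler_pdivrMr ?ltr0n // mul1r gerBl.
Qed.

Lemma window_ge0 n a b : (0 < a <= b)%N -> 0 <= window n a b.
Proof.
move=> /andP[a0 ab]; rewrite mulr_ge0 // subr_ge0 lef_pV2 ?posrE ?ltr0n //.
  by rewrite ler_nat.
exact: leq_trans ab.
Qed.

Lemma window_scale n a b p : window n (p * a) (p * b) = window n a b / p%:R.
Proof. by rewrite /window !natrM !invfM -mulrBr; ring. Qed.

Lemma count_le_divn n a : (0 < a)%N ->
  \sum_(1 <= q < n.+1 | (a * q <= n)%N) (1 : R) = (n %/ a)%:R.
Proof.
move=> a0; rewrite (eq_bigl (fun q => (q < (n %/ a).+1)%N)); last first.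
  by move=> q; rewrite ltnS leq_divRL // mulnC.
rewrite -(big_nat_widen 1 _ n.+1 predT) ?ltnS ?leq_div //.
by rewrite sumr_const_nat subn1.
Qed.

Lemma divn_itv n a : (0 < a)%N ->
  n%:R / a%:R - 1 < (n %/ a)%:R :> R /\ (n %/ a)%:R <= n%:R / a%:R :> R.
Proof.
move=> a0; have aR : (0 : R) < a%:R by rewrite ltr0n.
rewrite ler_pdivlMr // ltrBlDr ltr_pdivrMr // natr1 -!natrM ler_nat ltr_nat.
by split; rewrite ?leq_divM ?ltn_ceil.
Qed.

Lemma rough_count_ge0 n i a b : 0 <= rough_count n i a b.
Proof. exact: sumr_ge0. Qed.

Lemma rough_count_split n i a b : (0 < a <= b)%N ->
  rough_count n 0 a b = (n %/ a)%:R - (n %/ b)%:R.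
Proof.
move=> /andP[a0 ab]; have b0 : (0 < b)%N by apply: leq_trans ab.
rewrite -!count_le_divn // (bigID (fun q => (b * q <= n)%N)) /= addrC.
rewrite [X in _ = _ + X - _](eq_bigl (fun q => (b * q <= n)%N)); last first.
  by move=> q /=; case: (leqP (b * q)%N n) => bq; rewrite ?andbF // andbT; nia.
rewrite addrK /rough_count [LHS]big_nat_cond [RHS]big_nat_cond.
apply: eq_bigl => q; case: (boolP (1 <= q < _)%N) => //= /andP[q0 _].
have -> : ((upto 0)^'%N).-nat q.
  by apply/pnatP => // p /prime_gt0 p0 _; rewrite !inE -ltnNge.
by rewrite -ltnNge.
Qed.

Lemma rough_count0 n a b : (0 < a <= b)%N ->
  `|rough_count n 0 a b - window n a b| <= 1.
Proof.
move=> /[dup] abh /andP[a0 ab]; have b0 : (0 < b)%N by apply: leq_trans ab.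
rewrite rough_count_split // /window mulrBr.
have [] := divn_itv n a0; have [] := divn_itv n b0.
by move=> *; rewrite ler_norml; lra.
Qed.

(** Buchstab's identity: the i-rough multiples of the prime [p = i.+1] are the [p * q] with [q]
    i-rough, because [p] is itself i-rough. *)
Lemma rough_countS n i a b : prime i.+1 -> (0 < a <= b)%N ->
  rough_count n i.+1 a b =
  rough_count n i a b - rough_count n i (i.+1 * a) (i.+1 * b).
Proof.
move=> p_pr /andP[a0 ab]; apply/esym/eqP; rewrite subr_eq; apply/eqP/esym.
rewrite [X in _ + X](_ : _ = \sum_(1 <= q < n.+1 | (i.+1 %| q)%N &&
    (((upto i)^'%N).-nat q && (a * q <= n < b * q)%N)) 1); last first.
  rewrite sum_multiples // /rough_count [LHS]big_nat_cond [RHS]big_nat_cond.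
  apply: eq_bigl => q; case: (boolP (1 <= q < _)%N) => //= /andP[q0 _].
  have -> : ((upto i)^'%N).-nat (i.+1 * q)%N = ((upto i)^'%N).-nat q.
    by rewrite pnatM pnatE // !inE ltnn.
  have -> : (i.+1 * a * q = a * (i.+1 * q))%N by lia.
  have -> : (i.+1 * b * q = b * (i.+1 * q))%N by lia.
  (* The condition [i.+1 * q <= n] added by the reindexing follows from [a * (i.+1 * q) <= n], as
     [a >= 1]. *)
  apply/and3P/and4P => [[h1 h2 h3]|[h0 h1 h2 h3]]; split => //.
  by nia.
rewrite [RHS](bigID (fun q => (i.+1 %| q)%N)) /= addrC; congr (_ + _);
  last by apply: eq_bigl => q; rewrite andbC.
rewrite /rough_count [LHS]big_nat_cond [RHS]big_nat_cond.
apply: eq_bigl => q; case: (boolP (1 <= q < _)%N) => //= /andP[q0 _].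
by rewrite rough_prime // andbAC.
Qed.

Lemma rough_count_nprime n i a b : ~~ prime i.+1 ->
  rough_count n i.+1 a b = rough_count n i a b.
Proof.
move=> npr; rewrite /rough_count [LHS]big_nat_cond [RHS]big_nat_cond.
apply: eq_bigl => q; case: (boolP (1 <= q < _)%N) => //= /andP[q0 _].
by rewrite rough_nprime.
Qed.

Lemma rough_count_le n i a b : (0 < a <= b)%N ->
  rough_count n i a b <= window n a b + 1.
Proof.
move=> abh; elim: i => [|i IH].
  by have := rough_count0 n abh; rewrite ler_norml => /andP[]; lra.
have [p_pr|npr] := boolP (prime i.+1); last by rewrite rough_count_nprime.
by rewrite rough_countS // (le_trans _ IH) // gerBl rough_count_ge0.
Qed.

(* Unfolding Buchstab's identity [rough_countS] to depth [k] replaces a truncated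
   inclusion-exclusion; the factor of [z ^- k] is Rankin's bound for the
   [k]-th elementary symmetric function of the [1 / p]. *)
Lemma rough_count_sieve n i a b k z : (0 < a <= b)%N -> 1 <= z ->
  `|rough_count n i a b - window n a b * sift_density i| <=
  i.+1%:R ^+ k
    + window n a b * (z ^- k * \prod_(1 <= p < i.+1 | prime p) (1 + z / p%:R)).
Proof.
move=> abh z1; have z0 : 0 < z by apply: lt_le_trans z1.
pose W i := \prod_(1 <= p < i.+1 | prime p) (1 + z / p%:R).
have W1 j : 1 <= W j.
  elim: j => [|j IH]; first by rewrite /W big_geq.
  rewrite /W big_prime_recr /=; case: ifP => // _.
  by rewrite mulr_ege1 // lerDl divr_ge0 // ltW.
have W0 j : 0 <= W j by apply: le_trans (W1 j).
elim: i k a b abh => [|i IH] k a b abh; rewrite -/(W _).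
  rewrite /sift_density big_geq // mulr1 expr1n.
  apply: (le_trans (rough_count0 n abh)); rewrite lerDl.
  by rewrite mulr_ge0 ?window_ge0 // mulr_ge0 ?W0 // invr_ge0 exprn_ge0 // ltW.
have H0 := window_ge0 n abh.
(* At depth 0 no cancellation is sought: the count and its main term both lie between 0 and the
   window length plus 1, and [W >= 1]. *)
case: k => [|k].
  rewrite !expr0 invr1 mul1r ler_norml.
  have := rough_count_le n i.+1 abh; have := rough_count_ge0 n i.+1 a b.
  have : 0 <= window n a b * sift_density i.+1.
    by rewrite mulr_ge0 // sift_density_ge0.
  have : window n a b * sift_density i.+1 <= window n a b.
    by rewrite ler_piMr // sift_density_le1.
  have : window n a b <= window n a b * W i.+1 by rewrite ler_peMr.
  by move=> *; apply/andP; split; lra.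
have [p_pr|npr] := boolP (prime i.+1); last first.
  rewrite rough_count_nprime // /sift_density /W !big_prime_recr (negbTE npr) /=.
  apply: (le_trans (IH k.+1 a b abh)); rewrite lerD2r lerXn2r ?nnegrE //.
  by rewrite ler_nat.
rewrite rough_countS // /sift_density /W !big_prime_recr p_pr /=.
rewrite -/(sift_density i) -/(W i).
have pabh : (0 < i.+1 * a <= i.+1 * b)%N by move: abh; nia.
have h1 := IH k.+1 a b abh; have h2 := IH k _ _ pabh.
rewrite window_scale -/(W _) in h2; rewrite -/(W _) in h1.
set p : R := i.+1%:R in h1 h2 *; have p0 : 0 < p by rewrite ltr0n.
set N1 := rough_count _ _ _ _ in h1 *; set N2 := rough_count _ _ _ _ in h2 *.
set H := window _ _ _ in H0 h1 h2 *.
have -> : N1 - N2 - H * (sift_density i * ((p - 1) / p)) =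
    (N1 - H * sift_density i) - (N2 - H / p * sift_density i).
  by field; rewrite gt_eqF.
apply: (le_trans (ler_normB _ _)); apply: (le_trans (lerD h1 h2)).
(* The level of depth lost in the subtracted term is paid for by the new factor:
   [z ^- k / p = z ^- k.+1 * (z / p)]. *)
have -> : H * (z ^- k.+1 * (W i * (1 + z / p))) =
    H * (z ^- k.+1 * W i) + H / p * (z ^- k * W i).
  by rewrite exprS; field; rewrite !gt_eqF ?exprn_gt0.
rewrite addrACA lerD2r.
(* What remains is p^(k+1) + p^k = p^k (p + 1) <= (p + 1)^(k+1). *)
have -> : i.+2%:R = p + 1 :> R by rewrite /p natr1.
have pk : p ^+ k <= (p + 1) ^+ k by rewrite lerXn2r ?nnegrE; lra.
by rewrite !exprS; nra.
Qed.

End Sieve.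

(** * Smooth numbers *)

Section SmoothSums.
Variable R : realType.
Implicit Types (d i k m n J N : nat) (z : R) (g : nat -> R).

Lemma le_ln (x y : R) : 0 < x -> x <= y -> ln x <= ln y.
Proof.
move=> x0 xy; rewrite -ler_expR !lnK ?posrE //.
exact: lt_le_trans xy.
Qed.

Lemma ler_sum_pred (P Q : pred nat) (F : nat -> R) m n :
  (forall d, (m <= d < n)%N -> P d -> Q d) -> (forall d, 0 <= F d) ->
  \sum_(m <= d < n | P d) F d <= \sum_(m <= d < n | Q d) F d.
Proof.
move=> PQ F0; rewrite [leLHS]big_mkcond [leRHS]big_mkcond.
apply: ler_sum_nat => d d_itv; have := PQ d d_itv.
by case: (P d) => [/(_ isT) -> //|_]; case: ifP.
Qed.

(** The multiples of a new prime [p] contribute at most [g p] times the whole sum, since the cutoff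
    at [N] only drops terms. Hence the sum times [1 - g p] is at most the sum for the smaller
    primes. *)
Lemma smooth_sum_euler g i N :
  g 1%N = 1 -> (forall d, 0 <= g d) ->
  (forall m n, (0 < m)%N -> (0 < n)%N -> g (m * n)%N = g m * g n) ->
  (forall p, prime p -> (p <= i)%N -> g p < 1) ->
  \sum_(1 <= d < N.+1 | (upto i).-nat d) g d
    <= \prod_(1 <= p < i.+1 | prime p) (1 - g p)^-1.
Proof.
move=> g1 g0 gM; elim: i => [|i IH] glt1.
  rewrite big_geq // (@le_trans _ _ (\sum_(1 <= d < N.+1 | d == 1%N) g d)) //.
    apply: ler_sum_pred => // d /andP[d_gt0 _] d_smooth; apply: contraTT isT => d1.
    have d_gt1 : (1 < d)%N by lia.
    have /pnatP := d_smooth.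
    by move=> /(_ d_gt0 _ (pdiv_prime d_gt1) (pdiv_dvd d)); rewrite inE leqNgt pdiv_gt0.
  by rewrite big_nat1_eq; case: ifP; rewrite ?g1.
rewrite big_prime_recr; have [p_pr|npr] /= := boolP (prime i.+1); last first.
  apply: le_trans (IH _); last by move=> p pp ip; apply: glt1 => //; lia.
  apply: ler_sum_pred => // d /andP[d_gt0 _]; by rewrite upto_nprime.
have gp1 : g i.+1 < 1 by exact: glt1.
rewrite ler_pdivlMr ?subr_gt0 //.
apply: le_trans (IH _); last by move=> p pp ip; apply: glt1 => //; lia.
rewrite mulrBr mulr1 lerBlDr.
rewrite [leLHS](bigID (fun d => (i.+1 %| d)%N)) /= addrC lerD //.
  apply: ler_sum_pred => // d /andP[d_gt0 _] /andP[d_smooth ndvd].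
  apply/pnatP => // p pp pd; have /pnatP := d_smooth.
  move=> /(_ d_gt0 _ pp pd); rewrite !inE leq_eqVlt => /orP[/eqP pE|//].
  by rewrite -pE pd in ndvd.
rewrite (eq_bigl (fun d => (i.+1 %| d)%N && (upto i.+1).-nat d)); last first.
  by move=> d; rewrite andbC.
rewrite sum_multiples // mulrC mulr_sumr.
rewrite (_ : \sum_(1 <= q < N.+1 | _) _ =
  \sum_(1 <= q < N.+1 | (i.+1 * q <= N)%N && (upto i.+1).-nat (i.+1 * q)%N)
     g i.+1 * g q); last first.
  by rewrite [LHS]big_nat_cond [RHS]big_nat_cond; apply: eq_bigr => q /andP[/andP[q0 _] _]; rewrite gM.
apply: ler_sum_pred => [q _ /andP[_]|q]; last by rewrite mulr_ge0.
by rewrite pnatM => /andP[].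
Qed.

(** The Euler product is the inverse of [sift_density]; this is why the inner sums of C_f converge
    absolutely, with bounds summable over [i]. *)
Lemma smooth_recip_density i N :
  (\sum_(1 <= d < N.+1 | (upto i).-nat d) d%:R^-1) * sift_density R i <= 1.
Proof.
have g0 d : 0 <= (d%:R^-1 : R) by rewrite invr_ge0.
have : \sum_(1 <= d < N.+1 | (upto i).-nat d) d%:R^-1
    <= \prod_(1 <= p < i.+1 | prime p) (1 - p%:R^-1 : R)^-1.
  apply: (@smooth_sum_euler (fun d => d%:R^-1)) => //; first by rewrite invr1.
    by move=> m n _ _; rewrite natrM invfM.
  by move=> p pp _; rewrite invf_lt1 ?ltr0n ?prime_gt0 // ltr1n prime_gt1.
move=> /(ler_wpM2r (sift_density_ge0 R i)) /le_trans; apply.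
rewrite -big_split /= le_eqVlt big1 ?eqxx // => p pp.
have p1 : (1 : R) < p%:R by rewrite ltr1n prime_gt1.
by field; rewrite subr_eq0 !gt_eqF //; lra.
Qed.

(** On this range (1 - x)(1 + 4x) = 1 + x(3 - 4x) >= 1. *)
Lemma inv_onem_le_expR (x : R) : 0 <= x <= 3 / 4 -> (1 - x)^-1 <= expR (4 * x).
Proof.
move=> /andP[x0 x1]; apply: le_trans (expR_ge1Dx _).
by rewrite -[leLHS]mul1r ler_pdivrMr; nra.
Qed.

Lemma rankin_smooth_sum J N z : (1 < J)%N -> 1 <= z -> z ^+ 2 <= J%:R ->
  \sum_(1 <= d < N.+1 | (upto J).-nat d) expR (ln z / ln J%:R * ln d%:R) / d%:R
    <= expR (4 * z * recip_primes R J).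
Proof.
move=> J1 z1 z2J; set s := ln z / ln J%:R.
have z0 : 0 < z by apply: lt_le_trans z1.
have JR : (1 : R) < J%:R by rewrite ltr1n.
have lnJ : 0 < ln (J%:R : R) by rewrite ln_gt0.
have s0 : 0 <= s by rewrite divr_ge0 ?ln_ge0 // ltW.
have s2 : s * 2 <= 1.
  rewrite /s mulrAC ler_pdivrMr // mul1r mulrC mulr_natl -lnXn //.
  by apply: le_ln => //; rewrite exprn_gt0.
pose g d : R := expR (s * ln d%:R) / d%:R.
(* From [s <= 1/2] comes p^(s-1) <= p^(-1/2) <= 3/4, the range needed for [inv_onem_le_expR]; the
   second bound is p^s <= J^s = z. *)
have gp p : prime p -> (p <= J)%N -> 0 <= g p <= 3 / 4 /\ g p <= z / p%:R.
  move=> pp pJ; have p1 := prime_gt1 pp.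
  have p0 : (0 : R) < p%:R by rewrite ltr0n; lia.
  have p2 : (2 : R) <= p%:R by rewrite ler_nat.
  have lnp : 0 <= ln (p%:R : R) by rewrite ln_ge0 //; lra.
  have e0 : 0 <= expR (s * ln (p%:R : R)) by exact: expR_ge0.
  have sq : expR (s * ln p%:R) ^+ 2 <= p%:R :> R.
    rewrite -expRM_natl -[leRHS]lnK ?posrE // ler_expR.
    by rewrite mulrA [2 * s]mulrC ler_piMl.
  split; last first.
    rewrite ler_pM2r ?invr_gt0 // -[leRHS]lnK ?posrE // ler_expR.
    rewrite /s mulrAC ler_pdivrMr // ler_wpM2l ?ln_ge0 //.
    by apply: le_ln; rewrite ?ler_nat.
  rewrite divr_ge0 ?expR_ge0 ?ler0n //= ler_pdivrMr //.
  by rewrite -(@ler_pXn2r _ 2) ?nnegrE //; nra.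

apply: (le_trans (@smooth_sum_euler g J N _ _ _ _)).
- by rewrite /g ln1 mulr0 expR0 divr1.
- by move=> d; rewrite divr_ge0 ?expR_ge0.
- move=> m n m0 n0; rewrite /g natrM lnM ?posrE ?ltr0n // mulrDr expRD invfM.
  by ring.
- by move=> p pp pJ; have [/andP[_ h] _] := gp p pp pJ; lra.
rewrite /recip_primes mulr_sumr expR_sum.
rewrite big_nat_cond [leRHS]big_nat_cond.
apply: ler_prod => p /andP[/andP[_ pJ] pp].
have [h1 h2] := gp p pp pJ; have [/andP[h3 h4]] := h1.
rewrite invr_ge0 subr_ge0 (le_trans h4) /=; last by lra.
apply: (le_trans (inv_onem_le_expR h1)); rewrite ler_expR -!mulrA.
by rewrite ler_pM2l.
Qed.

(** On this range the Rankin weight is at least [z ^+ k]. The case [k = 0] serves later as a bound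
    for the full sum. *)
Lemma smooth_tail J N z k : (1 < J)%N -> 1 <= z -> z ^+ 2 <= J%:R ->
  \sum_(1 <= d < N.+1 | (upto J).-nat d && (J ^ k <= d)%N) d%:R^-1
    <= z ^- k * expR (4 * z * recip_primes R J).
Proof.
move=> J1 z1 z2J; have z0 : 0 < z by apply: lt_le_trans z1.
have JR : (1 : R) < J%:R by rewrite ltr1n.
have lnJ : 0 < ln (J%:R : R) by rewrite ln_gt0.
apply: le_trans (ler_wpM2l _ (rankin_smooth_sum N J1 z1 z2J)); last first.
  by rewrite invr_ge0 exprn_ge0 // ltW.
rewrite mulr_sumr.
apply: le_trans (ler_sum_pred (P := fun d => (upto J).-nat d && (J ^ k <= d)%N) _ _);
  first last.
- by move=> d; rewrite mulr_ge0 ?divr_ge0 ?expR_ge0 // invr_ge0 exprn_ge0 // ltW.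
- by move=> d _ /andP[].
rewrite big_nat_cond [leRHS]big_nat_cond.
apply: ler_sum => d /andP[/andP[d0 _] /andP[_ Jkd]].
rewrite mulrA ler_peMl ?invr_ge0 // mulrC ler_pdivlMr ?exprn_gt0 // mul1r.
rewrite -[leLHS]lnK ?posrE ?exprn_gt0 // ler_expR lnXn //.
rewrite mulrAC ler_pdivlMr // -[ln z *+ k]mulr_natr -mulrA ler_wpM2l ?ln_ge0 //.
by rewrite mulr_natl -lnXn ?ltr0n ?(ltnW J1) //; apply: le_ln; rewrite -natrX ?ler_nat ?ltr0n ?expn_gt0 ?(ltnW J1).
Qed.

Lemma prod_onep_le_expR i z : 0 <= z ->
  \prod_(1 <= p < i.+1 | prime p) (1 + z / p%:R) <= expR (z * recip_primes R i).
Proof.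
move=> z0; rewrite /recip_primes mulr_sumr expR_sum.
apply: ler_prod => p _; rewrite expR_ge1Dx andbT.
by rewrite addr_ge0 // divr_ge0.
Qed.

End SmoothSums.

(** * Chebyshev's bound for the sum of 1/p *)

Lemma prod_primes_dvd (a b N : nat) :
  (forall p, (a <= p < b)%N -> prime p -> (p %| N)%N) ->
  (\prod_(a <= p < b | prime p) p %| N)%N.
Proof.
elim: b => [|b IH] hN; first by rewrite big_geq.
have [ba|ab] := ltnP b a; first by rewrite big_geq.
rewrite big_mkcond big_nat_recr //= -big_mkcond.
have IHN : (\prod_(a <= p < b | prime p) p %| N)%N.
  by apply: IH => p /andP[ap pb]; apply: hN; rewrite ap ltnS ltnW.
case: ifP => [b_pr|_]; last by rewrite muln1.
rewrite Gauss_dvd ?IHN ?hN ?ab //= coprime_sym prime_coprime // big_seq_cond.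
apply: (big_ind (fun x => ~~ (b %| x)%N)) => [|x y hx hy|p].
- by rewrite dvdn1 neq_ltn prime_gt1 ?orbT.
- by rewrite Euclid_dvdM // negb_or hx.
rewrite mem_index_iota => /andP[/andP[_ pb] pp].
by rewrite dvdn_prime2 // neq_ltn pb orbT.
Qed.

(** The prime divides (2m)! but, exceeding [m], does not divide m!. *)
Lemma prime_dvd_central_bin (m p : nat) :
  prime p -> (m < p <= m.*2)%N -> (p %| 'C(m.*2, m))%N.
Proof.
move=> pp /andP[mp pm]; have le_m2 : (m <= m.*2)%N by lia.
have : (p %| (m.*2)`!)%N by rewrite dvdn_fact // prime_gt0.
have ndvd n : (n < p)%N -> ~~ (p %| n`!)%N.
  elim: n => [|n IH] np; first by rewrite dvdn1 neq_ltn prime_gt1 ?orbT.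
  by rewrite factS Euclid_dvdM // negb_or IH ?gtnNdvd // ltnW.
rewrite -(bin_fact le_m2) !Euclid_dvdM // -addnn addnK.
by rewrite (negbTE (ndvd m mp)) !orbF.
Qed.

Lemma central_bin_le (m : nat) : ('C(m.*2, m) <= 2 ^ m.*2)%N.
Proof.
rewrite -[2%N]/(1 + 1)%N expnDn.
have im : (m < m.*2.+1)%N by lia.
rewrite (bigD1 (Ordinal im)) //= !exp1n !muln1.
exact: leq_addr.
Qed.

(** The primes of the block all exceed 2^j, and their product divides a central binomial coefficient
    of size at most 2^(2^(j+1)); exponents of 2 are compared. *)
Lemma primes_dyadic (j : nat) :
  (j * \sum_((2 ^ j).+1 <= p < (2 ^ j.+1).+1 | prime p) 1 <= 2 ^ j.+1)%N.
Proof.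
have dE : (2 ^ j.+1 = (2 ^ j).*2)%N by rewrite expnS mul2n.
rewrite -(@leq_exp2l 2) //.
apply: (@leq_trans 'C((2 ^ j).*2, 2 ^ j)); last by rewrite dE central_bin_le.
apply: (@leq_trans (\prod_((2 ^ j).+1 <= p < (2 ^ j.+1).+1 | prime p) p)).
  rewrite big_distrr /= expn_sum big_nat_cond [leqRHS]big_nat_cond.
  by apply: leq_prod => p /andP[/andP[jp _] _]; rewrite muln1 ltnW.
apply: dvdn_leq; first by rewrite bin_gt0; lia.
by apply: prod_primes_dvd => p; rewrite dE => h pp; apply: prime_dvd_central_bin.
Qed.

Section Mertens.
Variable R : realType.

Lemma recip_primes_mono (i j : nat) : (i <= j)%N ->
  recip_primes R i <= recip_primes R j.
Proof.
move=> ij; rewrite /recip_primes [leRHS](big_cat_nat (n := i.+1)) //= lerDl.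
by apply: sumr_ge0 => p _; rewrite invr_ge0.
Qed.

Lemma recip_primes_ge0 (i : nat) : 0 <= recip_primes R i.
Proof. by apply: sumr_ge0 => p _; rewrite invr_ge0. Qed.

Lemma recip_primes_dyadic (j : nat) : (0 < j)%N ->
  \sum_((2 ^ j).+1 <= p < (2 ^ j.+1).+1 | prime p) (p%:R^-1 : R) <= 2 / j%:R.
Proof.
move=> j0; have jR : (0 : R) < j%:R by rewrite ltr0n.
have PR : (0 : R) < (2 ^ j)%:R by rewrite ltr0n expn_gt0.
have h : j%:R * \sum_((2 ^ j).+1 <= p < (2 ^ j.+1).+1 | prime p) 1
    <= 2 * (2 ^ j)%:R :> R.
  have := primes_dyadic j; rewrite -(ler_nat R) natrM natr_sum expnS natrM.
  exact.
apply: (@le_trans _ _ ((2 ^ j)%:R^-1 *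
    \sum_((2 ^ j).+1 <= p < (2 ^ j.+1).+1 | prime p) 1)).
  rewrite mulr_sumr big_nat_cond [leRHS]big_nat_cond.
  apply: ler_sum => p /andP[/andP[jp _] _]; rewrite mulr1 lef_pV2 ?posrE ?ltr0n ?expn_gt0 //.
    by rewrite ler_nat ltnW.
  exact: leq_trans jp.
rewrite [leLHS]mulrC ler_pdivrMr // [leRHS]mulrAC ler_pdivlMr // [leLHS]mulrC.
exact: h.
Qed.

(** This is ln(1 - u) <= -u at u = 1/(x + 1); by telescoping it bounds harmonic sums by
    logarithms. *)
Lemma ln_inv_le (x : R) : 0 < x -> (x + 1)^-1 <= ln (x + 1) - ln x.
Proof.
move=> x0; have x1 : 0 < x + 1 by lra.
have : ln (1 + - (x + 1)^-1) <= - (x + 1)^-1.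
  by apply: le_ln1Dx; rewrite ltrN2 invf_lt1 //; lra.
have -> : 1 + - (x + 1)^-1 = x / (x + 1) by field; lra.
by rewrite lnM ?posrE ?invr_gt0 // lnV ?posrE //; lra.
Qed.

Lemma recip_primes_pow2 (m : nat) : (0 < m)%N ->
  recip_primes R (2 ^ m) <= 1 + 4 * ln m%:R.
Proof.
elim: m => // -[_ _|m IH _].
  rewrite ln1 mulr0 addr0 /recip_primes expn1 /index_iota /= !big_cons big_nil /=.
  by rewrite addr0 invf_le1 // ler1n.
rewrite /recip_primes (big_cat_nat (n := (2 ^ m.+1).+1)) //=; last first.
  by rewrite ltnS leq_exp2l.
apply: (le_trans (lerD (IH isT) (recip_primes_dyadic (ltn0Sn m)))).
have := @ln_inv_le m.+1%:R; rewrite natr1 ltr0n => /(_ isT).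
(* Passing to the denominator [m.+2] of [ln_inv_le] costs a factor 2, whence the constant 4. *)
have : 2 / m.+1%:R <= 4 / m.+2%:R :> R.
  by rewrite ler_pdivrMr // mulrAC ler_pdivlMr // -!natrM ler_nat; lia.
have key (a b v M : R) : M <= 4 * v -> v <= b - a ->
  1 + 4 * a + M <= 1 + 4 * b by move=> *; lra.
exact: key.
Qed.

Lemma ln2_ge : 2^-1 <= ln 2 :> R.
Proof. by have := @ln_inv_le 1 ltr01; rewrite ln1 subr0. Qed.

Lemma recip_primes_le (n : nat) : (3 <= n)%N ->
  recip_primes R n <= 9 + 4 * ln (ln n%:R).
Proof.
move=> n3; set t := trunc_log 2 n.
have tn : (2 ^ t <= n)%N by rewrite trunc_logP //; lia.
have nt : (n < 2 ^ t.+1)%N by rewrite trunc_log_ltn.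
have n0 : (0 : R) < n%:R by rewrite ltr0n; lia.
apply: (le_trans (recip_primes_mono (ltnW nt))).
apply: (le_trans (recip_primes_pow2 (ltn0Sn t))).
have l2 := ln2_ge.
have tl : t%:R * ln 2 <= ln (n%:R : R).
  by rewrite mulr_natl -lnXn //; apply: le_ln; rewrite ?exprn_gt0 // -natrX ler_nat.
have l1 : 2^-1 <= ln (n%:R : R).
  apply: (le_trans l2); apply: le_ln => //; rewrite ler_nat; lia.
(* Since ln 2 >= 1/2, both t and 1 are at most 2 ln n. With ln 4 <= 2 the final constant is 9 = 1 +
   4 * 2. *)
have t4 : t.+1%:R <= 4 * ln (n%:R : R).
  have : (0 : R) <= t%:R by []; rewrite -natr1; nra.
have : ln (t.+1%:R : R) <= ln (4 * ln (n%:R : R)) by apply: le_ln.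
have ln4 : ln 4 <= 2 :> R.
  have -> : (4 : R) = 2 ^+ 2 by rewrite -natrX.
  rewrite lnXn //; have := @le_ln1Dx R 1; rewrite -[1 + 1]/(2 : R); lra.
rewrite lnM ?posrE //; last by lra.
lra.
Qed.

End Mertens.

(** * The main estimate *)

Section AbsoluteConvergence.
Variables (R : realType) (u : nat -> R) (P : pred nat).
Let partial N := \sum_(1 <= d < N.+1 | P d) u d.

Lemma abs_sum_cvg (B : R) :
  (forall N, \sum_(1 <= d < N.+1 | P d) `|u d| <= B) -> cvgn partial.
Proof.
move=> uB; pose v k := if P k.+1 then u k.+1 else 0.
have -> : partial = series v.
  by apply/funext => N; rewrite /partial /series /= big_mkcond big_add1.
apply: normed_cvg; apply: nondecreasing_is_cvgn.
  by apply: nondecreasing_series => n _ _; exact: normr_ge0.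
exists B => _ [N _ <-]; apply: le_trans (uB N).
rewrite /series /= big_mkcond big_add1; apply: ler_sum => k _.
by rewrite /v; case: ifP; rewrite ?normr0.
Qed.

Lemma abs_sum_tail (D : nat) (B : R) : cvgn partial ->
  (forall N, \sum_(D.+1 <= d < N.+1 | P d) `|u d| <= B) ->
  `|limn partial - partial D| <= B.
Proof.
move=> cv uB.
have cv2 : `|partial N - partial D| @[N --> \oo] --> `|limn partial - partial D|.
  by apply: cvg_norm; apply: cvgB => //; exact: cvg_cst.
rewrite -(cvg_lim _ cv2) //; apply: limr_le.
  by apply/cvg_ex; eexists; exact: cv2.
exists D => // N /= DN; rewrite /partial (big_cat_nat (n := D.+1)) //=.
by rewrite addrAC subrr add0r (le_trans (ler_norm_sum _ _ _)).
Qed.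

End AbsoluteConvergence.

Lemma sum_telescope_inv (R : realType) (a b : nat) : (0 < a <= b)%N ->
  \sum_(a <= t < b) (t%:R * (t%:R + 1))^-1 = a%:R^-1 - b%:R^-1 :> R.
Proof.
move=> /andP[a0 ab].
rewrite (telescope_sumr_eq (fun t => - t%:R^-1)) // => [|t /andP[at_ _]].
  by rewrite opprK addrC.
have t0 : (0 : R) < t%:R by rewrite ltr0n; lia.
by rewrite -natr1; field; rewrite !gt_eqF //; lra.
Qed.

(** * Convergence of C_f, then comparison with the sum of [f] *)

Section Main.
Variables (R : realType) (A : R) (f : nat -> nat -> R).
Hypothesis A_ge0 : 0 <= A.
Hypothesis f_bounded : forall a n : nat, (1 <= a <= n)%N -> `|f a n| <= A.
Hypothesis f_component : depends_only_on_component f.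
Implicit Types (a d i k n q t J N : nat) (z : R).

(** The limiting proportion of the [a <= n] with [n %/ a = i]. *)
Let w i : R := (i%:R * (i%:R + 1))^-1.

Let w_ge0 i : 0 <= w i.
Proof. by rewrite invr_ge0 mulr_ge0 // addr_ge0. Qed.

Lemma sum_window i d : (0 < i)%N -> (0 < d)%N ->
  \sum_((i * d)%N <= t < (i.+1 * d)%N) (t%:R * (t%:R + 1))^-1 = w i / d%:R.
Proof.
move=> i0 d0; rewrite sum_telescope_inv; last by rewrite muln_gt0 i0 d0 leq_mul2r leqnSn orbT.
have iR : (0 : R) < i%:R by rewrite ltr0n.
have dR : (0 : R) < d%:R by rewrite ltr0n.
by rewrite /w !natrM -natr1; field; rewrite !gt_eqF //; lra.
Qed.

Lemma Cf_termE i d : Cf_term f i d =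
  \sum_((i * d)%N <= t < (i.+1 * d)%N)
    f d t * (t%:R * (t%:R + 1))^-1 * sift_density R i.
Proof. by []. Qed.

Let f_itv i d t : (0 < i)%N -> (0 < d)%N -> (i * d <= t < i.+1 * d)%N ->
  `|f d t| <= A.
Proof.
by move=> i0 d0 /andP[idt _]; apply: f_bounded; rewrite d0; nia.
Qed.

Lemma Cf_term_le i d : (0 < i)%N -> (0 < d)%N ->
  `|Cf_term f i d| <= A * w i * (d%:R^-1 * sift_density R i).
Proof.
move=> i0 d0; rewrite Cf_termE -mulr_suml normrM [X in _ * X <= _]ger0_norm ?sift_density_ge0 //.
rewrite mulrA ler_wpM2r ?sift_density_ge0 // -mulrA -sum_window // mulr_sumr.
apply: (le_trans (ler_norm_sum _ _ _)); apply: ler_sum_nat => t t_itv.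
by rewrite normrM [X in _ * X <= _]ger0_norm ?w_ge0 // ler_wpM2r ?w_ge0 ?(f_itv i0 d0).
Qed.

Let inner_pred i : (0 < i)%N -> forall d M (F : nat -> R), (0 < d)%N ->
  \sum_(d <= e < M | (max_pdiv e <= i)%N) F e =
  \sum_(d <= e < M | (upto i).-nat e) F e.
Proof.
move=> i0 d M F d0; rewrite big_nat_cond [RHS]big_nat_cond.
apply: eq_bigl => e; case: (boolP (d <= e < M)%N) => //= /andP[de _].
by rewrite max_pdiv_upto //; lia.
Qed.

Lemma Cf_inner_abs i d N : (0 < i)%N -> (0 < d)%N ->
  \sum_(d <= e < N.+1 | (max_pdiv e <= i)%N) `|Cf_term f i e| <=
  A * w i * ((\sum_(d <= e < N.+1 | (upto i).-nat e) e%:R^-1) * sift_density R i).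
Proof.
move=> i0 d0; rewrite inner_pred // mulr_suml mulr_sumr.
rewrite big_nat_cond [leRHS]big_nat_cond.
by apply: ler_sum => e /andP[/andP[de _] _]; apply: Cf_term_le => //; lia.
Qed.

Lemma Cf_inner_abs_le i N : (0 < i)%N ->
  \sum_(1 <= e < N.+1 | (max_pdiv e <= i)%N) `|Cf_term f i e| <= A * w i.
Proof.
move=> i0; apply: (le_trans (Cf_inner_abs N i0 (ltnSn 0))).
by rewrite ler_piMr ?smooth_recip_density // mulr_ge0.
Qed.

Lemma Cf_inner_cvg i : (0 < i)%N -> cvgn (Cf_inner_partial f i).
Proof. by move=> i0; apply: abs_sum_cvg => N; exact: Cf_inner_abs_le. Qed.

Let g i := limn (Cf_inner_partial f i).

Lemma Cf_inner_lim_le i : (0 < i)%N -> `|g i| <= A * w i.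
Proof.
(* At [D = 0] the partial sum is empty, so the tail is the whole sum. *)
move=> i0; have := abs_sum_tail (D := 0) (Cf_inner_cvg i0) (fun N => Cf_inner_abs_le N i0).
by rewrite big_geq // subr0.
Qed.

Lemma Cf_outer_abs (I : nat) N : (0 < I)%N ->
  \sum_(I <= i < N.+1) `|g i| <= A / I%:R.
Proof.
move=> I0; apply: (@le_trans _ _ (\sum_(I <= i < N.+1) A * w i)).
  by apply: ler_sum_nat => i /andP[Ii _]; apply: Cf_inner_lim_le; lia.
rewrite -mulr_sumr ler_wpM2l //.
have [NI|IN] := leqP N.+1 I; first by rewrite big_geq // invr_ge0.
by rewrite sum_telescope_inv ?I0 ?(ltnW IN) // gerBl invr_ge0.
Qed.

Lemma Cf_cvg : cvgn (Cf_partial f).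
Proof. by apply: (@abs_sum_cvg _ _ xpredT (A / 1)) => N; exact: Cf_outer_abs. Qed.

Lemma Cf_tail (I : nat) : `|Cf f - Cf_partial f I| <= A / I.+1%:R.
Proof.
by apply: (@abs_sum_tail _ g xpredT I) => [|N]; [exact: Cf_cvg|exact: Cf_outer_abs].
Qed.

Lemma Cf_le : `|Cf f| <= A.
Proof. by have := Cf_tail 0; rewrite /Cf_partial big_geq // subr0 divr1. Qed.

(** * Layers of constant quotient [n %/ a], split by the smooth part of [a] *)

Definition layer_sum n i d : R :=
  \sum_(1 <= q < n.+1 | [&& ((upto i)^'%N).-nat q, (d * q <= n)%N
                           & (n %/ (d * q) == i)%N]) f d (n %/ q)%N.

(** The smooth part is taken at level [i = n %/ a], so the cofactor [q] meets exactly the roughness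
    hypothesis of [depends_only_scale]. *)
Lemma sum_layers n i : (0 < i)%N ->
  \sum_(1 <= a < n.+1 | (n %/ a == i)%N) f a n =
  \sum_(1 <= d < n.+1 | (upto i).-nat d) layer_sum n i d.
Proof.
move=> i0; rewrite (sum_by_part _ (upto i)) big_nat_cond [RHS]big_nat_cond.
apply: eq_bigr => d /andP[/andP[d0 _] _].
rewrite /layer_sum big_nat_cond [RHS]big_nat_cond.
apply: eq_bigr => q /andP[/andP[q0 _] /and3P[q_rough dqn /eqP iE]].
by apply: depends_only_scale => //; rewrite iE.
Qed.

(** The [q] are grouped by [t = n %/ q]. As [n %/ (d * q) = t %/ d], the quotient is [i] exactly
    when [t] lies in the stated range. *)
Lemma layer_sumE n i d : (0 < i)%N -> (0 < d)%N ->
  layer_sum n i d =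
  \sum_((i * d)%N <= t < (i.+1 * d)%N) f d t * rough_count R n i t t.+1.
Proof.
move=> i0 d0; rewrite /rough_count.
under eq_bigr => t _ do rewrite mulr_sumr.
rewrite (exchange_big_dep (fun q => ((upto i)^'%N).-nat q)) /=; last first.
  by move=> t q _ /andP[].
rewrite /layer_sum big_mkcondr big_nat_cond [RHS]big_nat_cond.
apply: eq_bigr => q /andP[/andP[q0 qn] q_rough].
rewrite (eq_bigl (fun t => t == (n %/ q)%N)); last first.
  by move=> t; rewrite q_rough /= -leq_divRL // -ltn_divLR // ltnS -eqn_leq.
rewrite big_nat1_eq mulr1; congr (if _ then _ else _).
rewrite -(leq_divRL i _ d0) -(ltn_divLR _ _ d0) ltnS -eqn_leq -divnMA [(q * d)%N]mulnC eq_sym.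
(* [d * q <= n] is automatic: otherwise the quotient would be 0, while [i >= 1]. *)
case: eqP => [iE|]; rewrite ?andbF // andbT.
by apply: contraTT i0; rewrite -ltnNge iE => ?; rewrite divn_small.
Qed.

(** Roughness is ignored: a quotient equal to [i] already forces [i * d * q <= n]. This suffices for
    large [d]. *)
Lemma layer_sum_trivial n i d : (0 < i)%N -> (0 < d)%N ->
  `|layer_sum n i d| <= A * (n%:R / i%:R / d%:R).
Proof.
move=> i0 d0; apply: (@le_trans _ _ (A * (n %/ (i * d))%:R)); last first.
  rewrite ler_wpM2l // -mulrA -invfM -natrM.
  have id0 : (0 < i * d)%N by rewrite muln_gt0 i0.
  by have [_] := divn_itv R n id0.
rewrite -count_le_divn ?muln_gt0 ?i0 // mulr_sumr.
apply: (le_trans (ler_norm_sum _ _ _)).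
apply: (@le_trans _ _ (\sum_(1 <= q < n.+1 | [&& ((upto i)^'%N).-nat q,
    (d * q <= n)%N & (n %/ (d * q) == i)%N]) A * 1)).
  rewrite big_nat_cond [leRHS]big_nat_cond mulr1.
  apply: ler_sum => q /andP[/andP[q0 _] /and3P[_ dqn _]].
  by apply: f_bounded; rewrite d0 leq_divRL.
apply: ler_sum_pred => [q /andP[q0 _] /and3P[_ dqn /eqP iE]|q]; last by rewrite mulr1.
by rewrite -mulnA -leq_divRL ?muln_gt0 ?d0 // iE.
Qed.

(** * Errors after truncation at [J] and [k] *)

Section Truncation.
Variables (J k : nat) (z : R).
Hypotheses (J_gt1 : (1 < J)%N) (z_ge1 : 1 <= z) (z2_le : z ^+ 2 <= J%:R).

(** A common bound for the sum of 1/d over smooth [d], for its tail beyond [J ^ k] divided by [tau],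
    for the sieve product and for the harmonic sum below [J]. *)
Let E : R := expR (4 * z * recip_primes R J).
Let tau : R := z ^- k.

Let z_gt0 : 0 < z. Proof. exact: lt_le_trans z_ge1. Qed.

Let tau_ge0 : 0 <= tau. Proof. by rewrite invr_ge0 exprn_ge0 // ltW. Qed.

Let E_ge1 : 1 <= E.
Proof.
by rewrite -expR0 ler_expR !mulr_ge0 ?recip_primes_ge0 // ltW.
Qed.

Let smooth_recip_tail i N : (i < J)%N ->
  \sum_((J ^ k)%N <= d < N.+1 | (upto i).-nat d) d%:R^-1 <= tau * E.
Proof.
move=> iJ; apply: le_trans (smooth_tail N k J_gt1 z_ge1 z2_le).
have Jk : (0 < J ^ k)%N by rewrite expn_gt0; lia.
have [NJ|JN] := ltnP N.+1 (J ^ k).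
  by rewrite big_geq ?(ltnW NJ) //; apply: sumr_ge0 => d _; rewrite invr_ge0.
rewrite [leRHS](big_cat_nat (n := (J ^ k)%N)) //= -[leLHS]add0r lerD //.
  by apply: sumr_ge0 => d _; rewrite invr_ge0.
apply: ler_sum_pred => [d /andP[Jd _] d_s|d]; last by rewrite invr_ge0.
rewrite Jd andbT; apply: sub_in_pnat d_s => p _; rewrite !inE; lia.
Qed.

Let smooth_recip i N : (i < J)%N ->
  \sum_(1 <= d < N.+1 | (upto i).-nat d) d%:R^-1 <= E.
Proof.
move=> iJ; have := smooth_tail N 0 J_gt1 z_ge1 z2_le.
rewrite expr0 invr1 mul1r => /(le_trans _); apply.
apply: ler_sum_pred => [d /andP[d0 _] d_s|d]; last by rewrite invr_ge0.
rewrite expn0 d0 andbT; apply: sub_in_pnat d_s => p _; rewrite !inE; lia.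
Qed.

Let harmonic_le : \sum_(1 <= i < J) i%:R^-1 <= E.
Proof.
have := smooth_tail J.-1 0 J_gt1 z_ge1 z2_le.
rewrite expr0 invr1 mul1r prednK; last by lia.
move=> /(le_trans _); apply; rewrite [leLHS](eq_bigl xpredT) //.
apply: ler_sum_pred => [d /andP[d0 dJ] _|d]; last by rewrite invr_ge0.
rewrite expn0 d0 andbT; apply/pnatP => // p pp pd; rewrite inE.
by have := dvdn_leq d0 pd; lia.
Qed.

(** The sieve is applied for each of the [d] values of [t], with (i + 1)^k <= J^k; the window
    lengths add up to n w_i / d. *)
Lemma layer_sum_sieve n i d : (0 < i < J)%N -> (0 < d)%N ->
  `|layer_sum n i d - n%:R * Cf_term f i d| <=
  A * (d%:R * J%:R ^+ k + n%:R * (tau * E) * (w i / d%:R)).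
Proof.
move=> /andP[i0 iJ] d0; rewrite layer_sumE // Cf_termE mulr_sumr -sumrB.
apply: (@le_trans _ _ (\sum_((i * d)%N <= t < (i.+1 * d)%N)
   A * (J%:R ^+ k + n%:R * (tau * E) * (t%:R * (t%:R + 1))^-1))); last first.
  rewrite -mulr_sumr ler_wpM2l // big_split /= -mulr_sumr sum_window //.
  by rewrite lerD2r sumr_const_nat -mulnBl subSnn mul1n mulr_natl.
apply: (le_trans (ler_norm_sum _ _ _)); apply: ler_sum_nat => t t_itv.
have t0 : (0 < t)%N by move: t_itv; nia.
have tR : (0 : R) < t%:R by rewrite ltr0n.
have -> : f d t * rough_count R n i t t.+1
    - n%:R * (f d t * (t%:R * (t%:R + 1))^-1 * sift_density R i) =
    f d t * (rough_count R n i t t.+1 - window R n t t.+1 * sift_density R i).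
  by rewrite /window -natr1; field; rewrite !gt_eqF //; lra.
rewrite normrM; apply: ler_pM => //; first exact: (f_itv i0 d0 t_itv).
have tt : (0 < t <= t.+1)%N by rewrite t0 leqnSn.
apply: (le_trans (rough_count_sieve n i k tt z_ge1)); apply: lerD.
  by rewrite lerXn2r ?nnegrE // ler_nat.
have -> : window R n t t.+1 = n%:R * (t%:R * (t%:R + 1))^-1.
  by rewrite /window -natr1; field; rewrite !gt_eqF //; lra.
rewrite [leRHS]mulrAC; apply: ler_wpM2l; first by rewrite mulr_ge0 // w_ge0.
apply: ler_wpM2l => //.
apply: (le_trans (prod_onep_le_expR i (ltW z_gt0))).
rewrite ler_expR -mulrA; apply: (@le_trans _ _ (z * recip_primes R J)).
  by rewrite ler_wpM2l ?(ltW z_gt0) // recip_primes_mono // ltnW.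
by rewrite ler_peMl ?mulr_ge0 ?recip_primes_ge0 ?(ltW z_gt0) //; lra.
Qed.

Let w_le i : (0 < i)%N -> w i <= i%:R^-1.
Proof.
move=> i0; have iR : (0 : R) < i%:R by rewrite ltr0n.
by rewrite /w invfM ler_piMr ?invr_ge0 // invf_le1; lra.
Qed.

Lemma layer_error n i : (0 < i < J)%N -> (J ^ (3 * k + 2) <= n)%N ->
  `|\sum_(1 <= a < n.+1 | (n %/ a == i)%N) f a n - n%:R * g i| <=
  A * (J%:R ^+ (3 * k) + 3 * n%:R * (tau * E ^+ 2) * i%:R^-1).
Proof.
move=> iJh Jn; have /andP[i0 iJ] := iJh.
have Jk0 : (0 < J ^ k)%N by rewrite expn_gt0; lia.
have Jkn : (J ^ k <= n.+1)%N.
  by apply: (leq_trans _ (leqW Jn)); rewrite leq_exp2l //; lia.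
have iR : (0 : R) < i%:R by rewrite ltr0n.
have E0 : 0 <= E by apply: le_trans E_ge1.
rewrite sum_layers // (big_cat_nat (n := (J ^ k)%N)) //=.
set S1 := \sum_(1 <= d < _ | _) _; set S2 := \sum_(_ <= d < n.+1 | _) _.
set D := (J ^ k).-1; have DE : D.+1 = (J ^ k)%N by rewrite prednK.
set c := Cf_inner_partial f i D.
(* The pieces are bounded by the sieve for [d < J ^ k], by the trivial estimate for larger [d], and
   by the tail of the series [g i]. *)
have -> : S1 + S2 - n%:R * g i = (S1 - n%:R * c) + S2 - n%:R * (g i - c) by ring.
have h1 : `|S1 - n%:R * c| <=
    A * (J%:R ^+ (3 * k) + n%:R * (tau * E) * (w i * E)).
  rewrite /c /Cf_inner_partial DE inner_pred // mulr_sumr -sumrB.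
  apply: (@le_trans _ _ (\sum_(1 <= d < (J ^ k)%N | (upto i).-nat d)
     A * (J%:R ^+ k * J%:R ^+ k + n%:R * (tau * E) * w i * d%:R^-1))).
    apply: (le_trans (ler_norm_sum _ _ _)).
    rewrite big_nat_cond [leRHS]big_nat_cond.
    apply: ler_sum => d /andP[/andP[d0 dJ] _].
    apply: (le_trans (layer_sum_sieve n iJh d0)).
    rewrite ler_wpM2l // [_ * (w i / _)]mulrA lerD2r ler_wpM2r ?exprn_ge0 //.
    by rewrite -natrX ler_nat ltnW.
  rewrite -mulr_sumr ler_wpM2l // big_split /= lerD //.
    (* There are fewer than J^k values of [d], each with error at most J^(2k). *)
    rewrite -[leRHS](_ : J%:R ^+ k * (J%:R ^+ k * J%:R ^+ k) = _); last first.
      by rewrite -!exprD; congr (_ ^+ _); lia.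
    apply: (@le_trans _ _ (\sum_(1 <= d < (J ^ k)%N) (J%:R ^+ k * J%:R ^+ k))).
      by apply: ler_sum_pred => // d; rewrite mulr_ge0 ?exprn_ge0.
    rewrite sumr_const_nat -[_ *+ (_ - 1)]mulr_natl ler_wpM2r ?mulr_ge0 ?exprn_ge0 //.
    by rewrite -natrX ler_nat leq_subr.
  rewrite -mulr_sumr -!mulrA !ler_wpM2l ?w_ge0 //.
  by have := smooth_recip D iJ; rewrite DE.
have h2 : `|S2| <= A * (n%:R * (tau * E) * i%:R^-1).
  apply: (@le_trans _ _ (\sum_((J ^ k)%N <= d < n.+1 | (upto i).-nat d)
     A * (n%:R / i%:R * d%:R^-1))).
    apply: (le_trans (ler_norm_sum _ _ _)).
    rewrite big_nat_cond [leRHS]big_nat_cond.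
    apply: ler_sum => d /andP[/andP[Jd _] _].
    by apply: layer_sum_trivial => //; apply: leq_trans Jd.
  rewrite -!mulr_sumr ler_wpM2l // [leRHS]mulrAC ler_wpM2l ?divr_ge0 //.
  exact: smooth_recip_tail.
have h3 : `|g i - c| <= A * (w i * (tau * E)).
  apply: abs_sum_tail => [|N]; first exact: Cf_inner_cvg.
  rewrite DE; apply: (le_trans (Cf_inner_abs N i0 Jk0)).
  rewrite -mulrA !ler_wpM2l ?w_ge0 //.
  apply: le_trans (smooth_recip_tail N iJ).
  rewrite ler_piMr ?sift_density_le1 //.
  by apply: sumr_ge0 => d _; rewrite invr_ge0.
have wi := w_le i0; have wi0 := w_ge0 i.
apply: (le_trans (ler_normB _ _)); apply: (le_trans (lerD (ler_normD _ _) (lexx _))).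
rewrite normrM [`|n%:R|]ger0_norm //.
apply: (le_trans (lerD (lerD h1 h2) (ler_wpM2l (ler0n R n) h3))).
have -> : A * (J%:R ^+ (3 * k) + n%:R * (tau * E) * (w i * E))
    + A * (n%:R * (tau * E) / i%:R) + n%:R * (A * (w i * (tau * E))) =
  A * (J%:R ^+ (3 * k) + n%:R * (tau * (w i * E ^+ 2 + i%:R^-1 * E + w i * E))).
  by ring.
rewrite ler_wpM2l // lerD2l.
(* The 3 counts the three pieces, each contributing at most n tau E^2 / i. *)
have -> : 3 * n%:R * (tau * E ^+ 2) * i%:R^-1 =
  n%:R * (tau * (3 * (i%:R^-1 * E ^+ 2))) by ring.
rewrite !ler_wpM2l //.
have E2 : E <= E ^+ 2 by rewrite expr2 ler_peMl.
have i1 : 0 <= (i%:R^-1 : R) by rewrite invr_ge0.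
have a1 : w i * E ^+ 2 <= i%:R^-1 * E ^+ 2 by rewrite ler_wpM2r ?exprn_ge0.
have a2 : i%:R^-1 * E <= i%:R^-1 * E ^+ 2 by rewrite ler_wpM2l.
have a3 : w i * E <= i%:R^-1 * E ^+ 2 by rewrite ler_pM.
lra.
Qed.

(** The three terms 1/J come from the layers [i >= J], from the tail of C_f, and from fewer than J
    sieve errors J^(3k), whose total is at most n/J because J^(3k+2) <= n. *)
Lemma total_error n : (J ^ (3 * k + 2) <= n)%N ->
  `|\sum_(1 <= a < n.+1) f a n - n%:R * Cf f| <=
  A * n%:R * (3 / J%:R + 3 * tau * expR (12 * z * recip_primes R J)).
Proof.
move=> Jn; have JR : (0 : R) < J%:R by rewrite ltr0n; lia.
have E0 : 0 <= E by apply: le_trans E_ge1.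
rewrite (bigID (fun a => (n %/ a < J)%N)) /=.
set S1 := \sum_(_ <= a < _ | (_ < _)%N) _; set S2 := \sum_(_ <= a < _ | ~~ _) _.
have S1E : S1 = \sum_(1 <= i < J) \sum_(1 <= a < n.+1 | (n %/ a == i)%N) f a n.
  rewrite (exchange_big_dep xpredT) //= /S1 big_mkcond.
  apply: eq_big_nat => a /andP[a0 an].
  rewrite (eq_bigl (fun i => i == (n %/ a)%N)); last by move=> i; rewrite eq_sym.
  by rewrite big_nat1_eq divn_gt0 // -[(a <= n)%N]ltnS an.
have S2le : `|S2| <= A * (n%:R / J%:R).
  apply: (@le_trans _ _ (A * (n %/ J)%:R)); last first.
    by rewrite ler_wpM2l //; have [] := divn_itv R n (ltnW J_gt1).
  rewrite -count_le_divn; last by lia.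
  rewrite mulr_sumr; apply: (le_trans (ler_norm_sum _ _ _)).
  rewrite big_nat_cond [leRHS]big_nat_cond.
  rewrite (eq_bigl (fun q => (1 <= q < n.+1)%N && (J * q <= n)%N)); last first.
    move=> q; case: (boolP (1 <= q < _)%N) => //= /andP[q0 _].
    by rewrite -leqNgt leq_divRL.
  apply: ler_sum => q /andP[/andP[q0 qn] _]; rewrite mulr1.
  by apply: f_bounded; rewrite q0.
pose G := \sum_(1 <= i < J) g i.
have GE : G = Cf_partial f J.-1 by rewrite /G /Cf_partial prednK //; lia.
have tail : `|Cf f - G| <= A / J%:R.
  by rewrite GE; have := Cf_tail J.-1; rewrite prednK //; lia.
have mid : `|S1 - n%:R * G| <=
    A * (n%:R / J%:R + 3 * n%:R * (tau * E ^+ 2) * E).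
  rewrite S1E /G mulr_sumr -sumrB.
  apply: (@le_trans _ _ (\sum_(1 <= i < J)
      A * (J%:R ^+ (3 * k) + 3 * n%:R * (tau * E ^+ 2) * i%:R^-1))).
    apply: (le_trans (ler_norm_sum _ _ _)); apply: ler_sum_nat => i i_itv.
    exact: layer_error.
  rewrite -mulr_sumr ler_wpM2l // big_split /= lerD //; last first.
    by rewrite -mulr_sumr ler_wpM2l ?mulr_ge0 ?exprn_ge0.
  rewrite sumr_const_nat ler_pdivlMr // -[_ *+ (_ - 1)]mulr_natl.
  apply: (@le_trans _ _ (J%:R * J%:R ^+ (3 * k) * J%:R)).
    rewrite ler_wpM2r // ler_wpM2r ?exprn_ge0 // ler_nat; lia.
  by rewrite -natrX -!natrM ler_nat -expnS -expnSr (leq_trans _ Jn) // leq_exp2l //; lia.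
have -> : S1 + S2 - n%:R * Cf f = (S1 - n%:R * G) + S2 - n%:R * (Cf f - G) by ring.
apply: (le_trans (ler_normB _ _)); apply: (le_trans (lerD (ler_normD _ _) (lexx _))).
rewrite normrM [`|n%:R|]ger0_norm //.
apply: (le_trans (lerD (lerD mid S2le) (ler_wpM2l (ler0n R n) tail))).
(* Two factors [E] come from each layer and the third from the harmonic sum over [i]. *)
have -> : expR (12 * z * recip_primes R J) = E ^+ 3.
  by rewrite -expRM_natl; congr expR; ring.
by rewrite le_eqVlt; apply/orP; left; apply/eqP; ring.
Qed.

End Truncation.

End Main.

(** * Choice of the parameters *)

Section Asymptotics.
Variable R : realType.

Lemma expR_ge_sqr (x : R) : 0 <= x -> x ^+ 2 / 2 <= expR x.
Proof. by move=> x0; have := @expR_ge1Dxn R x 1 x0; rewrite !factS fact0; lra. Qed.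

(** ln 12 - ln 4 >= 1/5 + ... + 1/12 > 1. This makes log log n nonnegative from n = 3 on. *)
Lemma ln3_ge1 : 1 <= ln 3 :> R.
Proof.
have h (m : nat) : (0 < m)%N -> m.+1%:R^-1 <= ln (m.+1%:R : R) - ln m%:R.
  by move=> m0; have := @ln_inv_le R m%:R; rewrite ltr0n natr1 => /(_ m0).
have -> : ln 3 = ln 12 - ln 4 :> R.
  have -> : (12 : R) = 3 * 4 by rewrite -natrM.
  by rewrite lnM ?posrE //; lra.
have := h 4%N isT; have := h 5%N isT; have := h 6%N isT; have := h 7%N isT.
have := h 8%N isT; have := h 9%N isT; have := h 10%N isT; have := h 11%N isT.
lra.
Qed.

(** * Inequalities for [l] = log log n and [X] = sqrt(log n log log n) *)

Section Choice.
Variables (eps c X l : R).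
Hypotheses (eps_gt0 : 0 < eps) (eps_le : eps <= 12^-1).
Hypotheses (c_gt0 : 0 < c) (c_sqr : c ^+ 2 = 6^-1 - eps).
Hypotheses (X_gt0 : 0 < X) (X_sqr : X ^+ 2 = expR l * l).
Hypothesis l_large : (10 / eps) ^+ 3 <= l.

Let c_itv : 4^-1 <= c <= 2^-1.
Proof.
have c_le x y : 0 <= x -> 0 <= y -> x ^+ 2 <= y ^+ 2 -> x <= y :> R.
  by move=> x0 y0; rewrite ler_pXn2r ?nnegrE.
move: eps_gt0 eps_le c_gt0 => h1 h2 h3.
apply/andP; split; apply: c_le; rewrite ?c_sqr.
all: lra.
Qed.

Let l_eps : 10 ^+ 3 <= l * eps ^+ 3.
Proof. by rewrite -ler_pdivrMr ?exprn_gt0 // -expr_div_n. Qed.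

Let l_eps1 : 10 ^+ 3 <= l * eps.
Proof.
have l0 : 0 <= l.
  by apply: le_trans l_large; rewrite exprn_ge0 // divr_ge0 // ltW.
apply: (le_trans l_eps); rewrite ler_wpM2l // exprS ler_piMr ?(ltW eps_gt0) //.
by rewrite exprn_ile1 ?(ltW eps_gt0) //; move: eps_le => ?; lra.
Qed.

Let l_ge : 10 ^+ 3 <= l.
Proof. by move: l_eps1 eps_gt0 eps_le => h1 h2 h3; nra. Qed.

Lemma X_ge_expR : expR (l / 2) <= X.
Proof.
rewrite -(@ler_pXn2r _ 2) ?nnegrE ?expR_ge0 ?(ltW X_gt0) // X_sqr.
rewrite -expRM_natl mulrCA divff // mulr1 ler_peMr ?expR_ge0 //.
by move: l_ge; lra.
Qed.

Lemma X_ge_sqr : l ^+ 2 / 8 <= X.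
Proof.
apply: le_trans X_ge_expR; apply: le_trans (expR_ge_sqr _); last by move: l_ge; lra.
by rewrite le_eqVlt; apply/orP; left; apply/eqP; field.
Qed.

Lemma l_le_cX : l <= c * X.
Proof. by move: X_ge_sqr l_ge c_itv => h1 h2 /andP[h3 h4]; nra. Qed.

(** Absorbs the rounding in [L <= c * X + 1] into a factor 1 + 2 eps. *)
Lemma one_le_epscX : 1 <= 2 * eps * (c * X).
Proof.
have := l_le_cX; have := l_eps1; move: eps_gt0 => e0 h1 h2.
have : l * eps <= c * X * eps by rewrite ler_wpM2r // ltW.
lra.
Qed.

(** Ensures 2 log J <= log n, so that a depth [k >= 0] exists. *)
Lemma twice_cX_le : 2 * (c * X + 1) <= expR l.
Proof.
have h0 : 4 * l <= expR l.
  by apply: le_trans (expR_ge_sqr _); move: l_ge; nra.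
have h1 : X <= expR l / 2.
  rewrite -(@ler_pXn2r _ 2) ?nnegrE ?divr_ge0 ?expR_ge0 ?(ltW X_gt0) // X_sqr.
  by have := expR_gt0 l; nra.
by move: c_itv l_ge X_gt0 => /andP[_ c2] ? ?; nra.
Qed.

(** The exponent of [z] falls short of 1/2 by eps, so [l * z] is negligible against [X]; 160 covers
    all the secondary terms of the exponent balance. *)
Lemma savings : 16 * 10 * (l * expR ((2^-1 - eps) * l)) <= eps / 3 * X.
Proof.
apply: (@le_trans _ _ (eps / 3 * expR (l / 2))); last first.
  by rewrite ler_wpM2l ?X_ge_expR // divr_ge0 // ltW.
have -> : l / 2 = (2^-1 - eps) * l + eps * l by field.
rewrite expRD mulrCA mulrA [leRHS]mulrCA [leRHS]mulrC ler_wpM2r ?expR_ge0 //.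
have el0 : 0 <= eps * l by move: l_eps1; lra.
have h := expR_ge_sqr el0.
apply: (@le_trans _ _ (eps / 3 * ((eps * l) ^+ 2 / 2))); last first.
  by rewrite ler_wpM2l // divr_ge0 // ltW.
(* Here l eps^3 >= 1000 and 1000/6 > 160, which explains the cube in [l_large]. *)
have -> : eps / 3 * ((eps * l) ^+ 2 / 2) = l * (l * eps ^+ 3) / 6 by field.
by move: l_eps l_ge; nra.
Qed.

(* The exponent balance: [c^2 < 1/6] is exactly what makes [k (1/2) l], which is
   about [X / (6 c)], exceed [c X]. *)
Lemma exponent_balance (L kr : R) : 0 < L -> L <= c * X + 1 ->
  expR l / (3 * L) - 2 <= kr ->
  12 * expR ((2^-1 - eps) * l) * (9 + 4 * l) - kr * ((2^-1 - eps) * l) <= - (c * X).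
Proof.
move=> L0 LX kr_ge; set z := expR _.
have e0 := eps_gt0; have e1 := eps_le; have /andP[c1 c2] := c_itv; have l9 := l_ge; have x0 := X_gt0.
set kap := 2^-1 - eps.
have kap0 : 0 < kap by rewrite /kap; lra.
have LX2 : L <= c * (1 + 2 * eps) * X by have := one_le_epscX; lra.
(* By c^2 = 1/6 - eps and c <= 1/2 the left side is at most 1/2 - 3 eps / 2. The surplus eps/3
   beside [c] pays for [savings]. *)
have kapE : 3 * c * (1 + 2 * eps) * (c + eps / 3) <= kap.
  have -> : 3 * c * (1 + 2 * eps) * (c + eps / 3) =
    (1 + 2 * eps) * (3 * c ^+ 2 + eps * c) by field.
  by rewrite c_sqr /kap; nra.
have h1 : (c + eps / 3) * X <= expR l / (3 * L) * (kap * l).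
  rewrite mulrAC ler_pdivlMr; last by rewrite mulr_gt0.
  have -> : expR l * (kap * l) = kap * X ^+ 2 by rewrite X_sqr; ring.
  apply: (@le_trans _ _ ((c + eps / 3) * X * (3 * (c * (1 + 2 * eps) * X)))).
    by rewrite ler_wpM2l ?mulr_ge0 ?ler_wpM2l ?addr_ge0 ?divr_ge0 // ltW.
  have -> : (c + eps / 3) * X * (3 * (c * (1 + 2 * eps) * X)) =
    3 * c * (1 + 2 * eps) * (c + eps / 3) * X ^+ 2 by ring.
  by rewrite ler_wpM2r // exprn_ge0 // ltW.
have h2 : (expR l / (3 * L) - 2) * (kap * l) <= kr * (kap * l).
  by rewrite ler_wpM2r // mulr_ge0 ?ltW //; lra.
have z1 : 1 <= z by rewrite -expR0 ler_expR mulr_ge0 ?ltW //; lra.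
have h3 := savings; rewrite -/z in h3.
have h4 : l <= l * z by rewrite ler_peMr //; lra.
have h5 : 12 * z * (9 + 4 * l) <= 15 * 10 * (l * z).
  by nra.
have h6 : 2 * (kap * l) <= l by rewrite /kap; nra.
rewrite mulrBl in h2; rewrite mulrDl in h1.
lra.
Qed.

End Choice.

Lemma parameter_choice (eps : R) (n : nat) : 0 < eps -> eps <= 12^-1 ->
  (3 <= n)%N -> (10 / eps) ^+ 3 <= ln (ln n%:R) ->
  exists J k : nat, exists z : R,
    [/\ (1 < J)%N, 1 <= z, z ^+ 2 <= J%:R, (J ^ (3 * k + 2) <= n)%N &
      3 / J%:R + 3 * z ^- k * expR (12 * z * recip_primes R J) <=
      6 * expR (- Num.sqrt ((6^-1 - eps) * ln n%:R * ln (ln n%:R)))].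
Proof.
move=> eps0 eps1 n3; set l := ln (ln _) => l_large.
have n0 : (0 : R) < n%:R by rewrite ltr0n; lia.
have Lam0 : 0 < ln (n%:R : R) by rewrite ln_gt0 // ltr1n; lia.
have LamE : ln (n%:R : R) = expR l by rewrite /l lnK ?posrE.
have l0 : 0 < l by apply: lt_le_trans l_large; rewrite exprn_gt0 // divr_gt0.
rewrite -mulrA sqrtrM; last by lra.
set c := Num.sqrt _; set X := Num.sqrt _.
have c0 : 0 < c by rewrite sqrtr_gt0; lra.
have c2 : c ^+ 2 = 6^-1 - eps by rewrite sqr_sqrtr //; lra.
have X0 : 0 < X by rewrite sqrtr_gt0 mulr_gt0.
have X2 : X ^+ 2 = expR l * l by rewrite sqr_sqrtr ?LamE // mulr_ge0 ?expR_ge0 // ltW.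
(* Just above exp(cX), so that 1/J <= exp(-cX) and log J <= cX + 1. *)
pose J := (Num.truncn (expR (c * X))).+1.
have cX0 : 0 < c * X by rewrite mulr_gt0.
have eX1 : 1 <= expR (c * X) by rewrite -expR0 ler_expR ltW.
have /andP[J_le J_gt] := truncn_itv (le_trans ler01 eX1).
have J1 : (1 < J)%N by rewrite ltnS truncn_gt0.
have JR : (0 : R) < J%:R by rewrite ltr0n.
have L0 : 0 < ln (J%:R : R) by rewrite ln_gt0 // ltr1n.
have LX : ln (J%:R : R) <= c * X + 1.
  rewrite -ler_expR lnK ?posrE // expRD /J -natr1.
  have := @expR_ge1Dx R 1; have := expR_ge0 (c * X); nra.
rewrite -/J in J_gt; clear J_le; clearbody J; set L := ln (J%:R : R) in L0 LX.
have Lam2 : 2 * L <= expR l.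
  by have := twice_cX_le eps0 eps1 c0 c2 X0 X2 l_large; lra.
have q0 : 0 <= (expR l / L - 2) / 3.
  by rewrite divr_ge0 // subr_ge0 ler_pdivlMr.
(* The largest [k] with (3k + 2) log J <= log n. *)
pose k := Num.truncn ((expR l / L - 2) / 3).
have /andP[k_le k_gt] := truncn_itv q0; rewrite -/k in k_le k_gt.
clearbody k.
have Jk : (J ^ (3 * k + 2) <= n)%N.
  rewrite -(ler_nat R) natrX -ler_ln ?posrE ?exprn_gt0 // lnXn // LamE -[_ *+ (_ + 2)]mulr_natr -/L.
  have : 3 * k%:R + 2 <= expR l / L by lra.
  by rewrite ler_pdivlMr // natrD natrM mulrC.
have kr_ge : expR l / (3 * L) - 2 <= k%:R.
  have -> : expR l / (3 * L) = expR l / L / 3 by field; rewrite gt_eqF.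
  by move: k_gt; rewrite -natr1; lra.
pose z := expR ((2^-1 - eps) * l).
have z1 : 1 <= z by rewrite -expR0 ler_expR mulr_ge0 ?(ltW l0) //; lra.
have Jn : (J <= n)%N by apply: leq_trans Jk; rewrite -[leqLHS]expn1 leq_exp2l // addn2.
exists J, k, z; split => //.
  apply: (le_trans _ (ltW J_gt)); rewrite -expRM_natl ler_expR.
  apply: le_trans (l_le_cX eps0 eps1 c0 c2 X0 X2 l_large).
  by rewrite mulrA ler_piMl ?(ltW l0) //; lra.
have -> : 6 * expR (- (c * X)) = 3 * expR (- (c * X)) + 3 * expR (- (c * X)).
  by ring.
rewrite lerD //.
  by rewrite ler_wpM2l // expRN lef_pV2 ?posrE ?expR_gt0 // ltW.
rewrite -mulrA ler_wpM2l // /z -expRM_natr -expRN -expRD ler_expR.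
apply: le_trans (exponent_balance eps0 eps1 c0 c2 X0 X2 l_large L0 LX kr_ge).
rewrite addrC [X in _ - X <= _]mulrC lerD2r -/z ler_wpM2l //.
  by rewrite mulr_ge0 // expR_ge0.
exact: le_trans (recip_primes_mono R Jn) (recip_primes_le R n3).
Qed.

End Asymptotics.

Theorem theorem2p2 (R : realType) (eps A : R) (eps_gt0 : 0 < eps)
    (A_ge0 : 0 <= A) :
  exists K : R, forall f : nat -> nat -> R,
    (forall a n : nat, (1 <= a <= n)%N -> `|f a n| <= A) ->
    depends_only_on_component f ->
    Cf_converges f /\
    forall n : nat, (3 <= n)%N ->
      `| \sum_(1 <= a < n.+1) f a n - n%:R * Cf f |
      <= K * (n%:R * expR (- Num.sqrt ((6^-1 - eps) * ln n%:R * ln (ln n%:R)))).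
Proof.
(* A smaller eps gives a stronger bound, and [e <= 1/12] keeps 1/6 - e positive. *)
pose e := Num.min eps 12^-1.
have e_gt0 : 0 < e by rewrite lt_min eps_gt0 invr_gt0 ltr0n.
have e_le : e <= 12^-1 by rewrite ge_min lexx orbT.
have e_eps : e <= eps by rewrite ge_min lexx.
pose l0 := (10 / e) ^+ 3.
(* The first term serves large [n]; the second serves log log n < l0, where the trivial bound 2An is
   used. Neither depends on [f]. *)
pose K := 6 * A + 2 * A * expR (expR l0).
have K0 : 0 <= 2 * A * expR (expR l0) by rewrite !mulr_ge0 // expR_ge0.
exists K => f f_bounded f_comp; split.
  by split => [i i0|]; [exact: (Cf_inner_cvg A_ge0 f_bounded)|exact: (Cf_cvg A_ge0 f_bounded)].
move=> n n3.
have n1 : (3 : R) <= n%:R by rewrite ler_nat.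
have Lam1 : 1 <= ln (n%:R : R).
  by apply: (le_trans (ln3_ge1 R)); apply: le_ln.
have l_ge0 : 0 <= ln (ln (n%:R : R)) by rewrite ln_ge0.
set Y := expR _.
apply: (@le_trans _ _ (K * (n%:R *
    expR (- Num.sqrt ((6^-1 - e) * ln n%:R * ln (ln n%:R)))))); last first.
  rewrite ler_wpM2l ?addr_ge0 ?mulr_ge0 // ler_wpM2l // ler_expR lerN2.
  (* For eps > 1/6 the radicand at [eps] can be negative, where [Num.sqrt] is 0; monotonicity still
     holds. *)
  rewrite ler_wsqrtr // -!mulrA ler_wpM2r ?mulr_ge0 ?(le_trans ler01 Lam1) //.
  by lra.
set Ye := expR _.
have Ye0 : 0 <= Ye by rewrite expR_ge0.
have [l_large|l_small] := leP l0 (ln (ln n%:R)).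
  have [J [k [z [J1 z1 z2 Jk bound]]]] := parameter_choice e_gt0 e_le n3 l_large.
  apply: (le_trans (total_error A_ge0 f_bounded f_comp J1 z1 z2 Jk)).
  rewrite mulrA; apply: (@le_trans _ _ (A * n%:R * (6 * Ye))).
    by rewrite ler_wpM2l // mulr_ge0.
  rewrite /K; have : 0 <= 2 * A * expR (expR l0) * (n%:R * Ye) by rewrite !mulr_ge0.
  by lra.
(* For small [n] both log n and log log n are at most exp(l0), hence so is the square root. *)
have Ye_ge : expR (- expR l0) <= Ye.
  rewrite ler_expR lerN2 -[leRHS]ger0_norm ?expR_ge0 // -sqrtr_sqr ler_wsqrtr //.
  have LamE : ln (n%:R : R) = expR (ln (ln n%:R)) by rewrite lnK // posrE; lra.
  have h1 : ln (n%:R : R) <= expR l0 by rewrite LamE ler_expR ltW.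
  have h2 : ln (ln (n%:R : R)) <= expR l0.
    by apply: (le_trans (ltW l_small)); have := @expR_ge1Dx R l0; lra.
  rewrite expr2 -mulrA; apply: (@le_trans _ _ (ln n%:R * ln (ln n%:R))).
    by rewrite ler_piMl ?mulr_ge0 //; lra.
  by rewrite ler_pM //; lra.
have h : `|\sum_(1 <= a < n.+1) f a n - n%:R * Cf f| <= 2 * A * n%:R.
  apply: (le_trans (ler_normB _ _)).
  have -> : 2 * A * n%:R = A * n%:R + n%:R * A by ring.
  rewrite lerD // ?normrM.
    apply: (le_trans (ler_norm_sum _ _ _)).
    apply: (@le_trans _ _ (\sum_(1 <= a < n.+1) A)).
      by apply: ler_sum_nat => a a_itv; exact: f_bounded.
    by rewrite sumr_const_nat subn1 mulr_natr.
  by rewrite ger0_norm // ler_wpM2l // (Cf_le A_ge0 f_bounded).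
apply: (le_trans h); rewrite /K.
have : 2 * A * n%:R <= 2 * A * n%:R * (expR (expR l0) * Ye).
  rewrite ler_peMr ?mulr_ge0 //.
  have := ler_wpM2l (expR_ge0 (expR l0)) Ye_ge.
  by rewrite -expRD subrr expR0.
have : 0 <= 6 * A * (n%:R * Ye) by rewrite !mulr_ge0.
by lra.
Qed.
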